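(* Let $\mathcal{A}$ be a unital $C^*$-algebra, $a\in \mathcal{A}$ and $f\in S(\mathcal{A})$. Then $$|f(a)|^2 \leq \frac{t}2 |f(a^2)|+ f\left( \Big(1-\frac{3t}{4}\Big)a^*a+ \frac{t}4 aa^*\right) \quad \text{ for all } t\in [0,1].$$ Furthermore, for all $t\in[0,1]$, $$v^{2}(a) \leq \frac{t}{2}v(a^2)+ \left\| \frac{t}{4}|a^*|^{2}+\Big(1-\frac{3t}{4}\Big)|a|^{2} \right\|$$ and $$v^{2}(a) \leq \frac{t}{2}v(a^2)+ \left\| \frac{t}{4}|a|^{2}+\Big(1-\frac{3t}{4}\Big)|a^*|^{2} \right\| .$$ In particular, for $t=1$, $$v^2(a) \leq \frac{1}{2}v(a^2)+\frac14 \left\| a^*a+aa^* \right\|.$$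
   Context: $\mathcal{A}$ is a unital $C^*$-algebra with unit $e$. $S(\mathcal{A})$ is the set of normalized states, i.e. continuous linear functionals $f$ on $\mathcal{A}$ with $f(e)=\|f\|=1$ (equivalently, positive linear functionals with $f(e)=1$). The algebraic numerical radius of $a$ is $v(a)=\sup\{|f(a)|: f\in S(\mathcal{A})\}$, and $v^2(a)$ means $(v(a))^2$. $|a|=(a^*a)^{1/2}$, so $|a^*|=(aa^* )^{1/2}$. *)

(* Defs.v *)
From HB Require Import structures.
From mathcomp Require Import all_boot all_order all_algebra.
From mathcomp Require Import all_classical all_reals topology normedtype.
From mathcomp Require Import complex.

Set Implicit Arguments.
Unset Strict Implicit.
Unset Printing Implicit Defensive.

Import Order.TTheory GRing.Theory Num.Theory numFieldNormedType.Exports.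

Local Open Scope classical_set_scope.
Local Open Scope ring_scope.

(* A norm over R[i] takes values in R[i] (in its nonnegative reals); [rnorm]
   is the same norm, with values in R. *)
Definition rnorm (R : realType) (V : normedModType R[i]) (x : V) : R :=
  complex.Re `|x|.

(* Unital complex C*-algebras. The HB hierarchy of the library does not admit
   a structure below both [GRing.Algebra] and [CompleteNormedModule], so the
   algebra structure is packed over the Banach space and installed afterwards
   on the carrier [cstar_sort A], which thus has both structures.
   As 1 != 0, the axiom [cstar_starN] gives `|1| = 1, which is not assumed. *)
Record cstarAlgType (R : realType) := CStarAlgType {
  cstar_base : completeNormedModType R[i] ;
  cstar_mul : cstar_base -> cstar_base -> cstar_base ;
  cstar_one : cstar_base ;
  cstar_mulA : associative cstar_mul ;
  cstar_mul1x : left_id cstar_one cstar_mul ;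
  cstar_mulx1 : right_id cstar_one cstar_mul ;
  cstar_mulDl : left_distributive cstar_mul +%R ;
  cstar_mulDr : right_distributive cstar_mul +%R ;
  cstar_one_neq0 : cstar_one != 0 ;
  cstar_scaleAl : forall (c : R[i]) x y,
    c *: cstar_mul x y = cstar_mul (c *: x) y ;
  cstar_scaleAr : forall (c : R[i]) x y,
    c *: cstar_mul x y = cstar_mul x (c *: y) ;
  cstar_normM : forall x y, `|cstar_mul x y| <= `|x| * `|y| ;
  cstar_star : cstar_base -> cstar_base ;
  cstar_starK : involutive cstar_star ;
  cstar_starD : {morph cstar_star : x y / x + y} ;
  cstar_starZ : forall (c : R[i]) x,
    cstar_star (c *: x) = Num.conj c *: cstar_star x ;
  cstar_starM : forall x y,
    cstar_star (cstar_mul x y) = cstar_mul (cstar_star y) (cstar_star x) ;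
  cstar_starN : forall x, `|cstar_mul (cstar_star x) x| = `|x| ^+ 2
}.

Definition cstar_sort (R : realType) (A : cstarAlgType R) : Type :=
  cstar_base A.
Coercion cstar_sort : cstarAlgType >-> Sortclass.

HB.instance Definition _ (R : realType) (A : cstarAlgType R) :=
  CompleteNormedModule.copy (cstar_sort A) (cstar_base A).

HB.instance Definition _ (R : realType) (A : cstarAlgType R) :=
  GRing.Zmodule_isNzRing.Build (cstar_sort A) (@cstar_mulA R A)
    (@cstar_mul1x R A) (@cstar_mulx1 R A) (@cstar_mulDl R A)
    (@cstar_mulDr R A) (cstar_one_neq0 A).

HB.instance Definition _ (R : realType) (A : cstarAlgType R) :=
  GRing.Lmodule_isLalgebra.Build R[i] (cstar_sort A) (@cstar_scaleAl R A).

HB.instance Definition _ (R : realType) (A : cstarAlgType R) :=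
  GRing.Lalgebra_isAlgebra.Build R[i] (cstar_sort A) (@cstar_scaleAr R A).

Definition star (R : realType) (A : cstarAlgType R) : A -> A :=
  @cstar_star R A.

Section CStarTheory.
Context (R : realType) (A : cstarAlgType R).
Implicit Types (a x y : A) (c : R[i]).

Lemma starK : involutive (@star R A).
Proof. exact: cstar_starK. Qed.

Lemma starD : {morph @star R A : x y / x + y}.
Proof. exact: cstar_starD. Qed.

Lemma starZ c x : star (c *: x) = Num.conj c *: star x.
Proof. exact: cstar_starZ. Qed.

Lemma starM x y : star (x * y) = star y * star x.
Proof. exact: cstar_starM. Qed.

Lemma starN x : `|star x * x| = `|x| ^+ 2.
Proof. exact: cstar_starN. Qed.

Lemma normM_le x y : `|x * y| <= `|x| * `|y|.
Proof. exact: cstar_normM. Qed.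

(* Dual norm of a functional. [sup] is 0 on unbounded sets, so the equation
   [opnorm f = 1] below does imply that the supremum is a genuine one. *)
Definition opnorm (f : {linear A -> R[i]^o}) : R :=
  sup [set rnorm (f x) | x in [set x : A | rnorm x <= 1]].

Definition states : set {linear A -> R[i]^o} :=
  [set f : {linear A -> R[i]^o} |
    [/\ continuous f, f 1 = 1 & opnorm f = 1]].

(* The supremum is over a set bounded by [rnorm a]. *)
Definition numradius a : R := sup [set rnorm (f a) | f in states].

Definition positive_elt x : Prop := exists y : A, x = star y * y.

(* The positive square root x^(1/2) of x, and 0 if there is none. *)
Definition cstar_sqrt x : A :=
  xget 0 [set y | positive_elt y /\ y ^+ 2 = x].

Definition cstar_abs a : A := cstar_sqrt (star a * a).

End CStarTheory.

(* Main.v *)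
Require Import Defs.
From HB Require Import structures.
From mathcomp Require Import all_boot all_order all_algebra.
From mathcomp Require Import all_classical all_reals topology normedtype.
From mathcomp Require Import complex.
From mathcomp Require Import ring lra.
From Stdlib Require Ncring Ncring_tac.
Set Implicit Arguments.
Unset Strict Implicit.
Unset Printing Implicit Defensive.
Import Order.TTheory GRing.Theory Num.Theory numFieldNormedType.Exports.
Local Open Scope classical_set_scope.
Local Open Scope ring_scope.
Local Open Scope complex_scope.


(* With the semi-inner product <x, y> = f(y^* x) of a state f, the bound is the
   convex combination with weights 1 - t and t of |f(a)|^2 <= f(a^* a) and of
   Buzano's inequality 4 |f(a)|^2 <= 2 |f(a^2)| + f(a^* a) + f(a a^* ); the
   bounds for v follow by taking suprema, for a and for a^*.

   What has to be proved about C*-algebras is f(a^* a) >= 0, and the existence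
   of |a|; both follow once a^* a is the square of a self-adjoint element, which
   is shown without spectral theory. The iteration y' = (x + y^2) / 2 converges
   for |x| <= 1 and yields the square root 1 - y of 1 - x. Put h = a^* a,
   k = (h^2)^(1/2) and g = k - h: then (a g)^* (a g) = - k g^2 is the opposite
   of a square, which forces a g = 0, g = 0 and h = k. *)

(** * Normalisation of identities in noncommutative rings *)

#[local] Instance nzRing_ops (T : nzRingType) :
  @Ncring.Ring_ops T 0 1 +%R *%R (fun x y : T => x - y) -%R eq := {}.

#[local] Instance nzRing_ring (T : nzRingType) :
  Ncring.Ring (Ro := nzRing_ops T).
Proof.
apply: (@Ncring.Build_Ring _ _ _ _ _ _ _ _ (nzRing_ops T)
  RelationClasses.eq_equivalence _ _ _ _ (@add0r T) (@addrC T) (@addrA T)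
  (@mul1r T) (@mulr1 T) (@mulrA T) (@mulrDl T) (fun x y z => mulrDr z x y)
  (fun _ _ => erefl) (@subrr T)); by move=> // x y -> // z t ->.
Qed.

Ltac ncring := Ncring_tac.non_commutative_ring.

(** * Real-valued norm and the first consequences of the C*-identity *)

Section RealNorm.
Context (R : realType) (A : cstarAlgType R).
Implicit Types (x y a : A) (c : R[i]).

Lemma realJ (r : R) : Num.conj (r%:C : R[i]) = r%:C.
Proof. exact: conjc_real. Qed.

Lemma rnormE (V : normedModType R[i]) (x : V) : `|x| = (rnorm x)%:C.
Proof. by rewrite /rnorm RRe_real// normr_real. Qed.

Lemma rnorm_ge0 (V : normedModType R[i]) (x : V) : 0 <= rnorm x.
Proof. by rewrite -ler0c -rnormE. Qed.

Lemma rnormD (V : normedModType R[i]) (x y : V) :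
  rnorm (x + y) <= rnorm x + rnorm y.
Proof. by rewrite -lecR rmorphD/= -!rnormE ler_normD. Qed.

Lemma rnormN (V : normedModType R[i]) (x : V) : rnorm (- x) = rnorm x.
Proof. by rewrite /rnorm normrN. Qed.

Lemma rnormB (V : normedModType R[i]) (x y : V) :
  rnorm (x - y) <= rnorm x + rnorm y.
Proof. by rewrite (le_trans (rnormD _ _))// rnormN. Qed.

Lemma rnorm0 (V : normedModType R[i]) : rnorm (0 : V) = 0.
Proof. by rewrite /rnorm normr0. Qed.

Lemma rnorm0_eq0 (V : normedModType R[i]) (x : V) : rnorm x = 0 -> x = 0.
Proof. by move=> x0; apply/normr0_eq0; rewrite rnormE x0. Qed.

Lemma rnormZ (V : normedModType R[i]) (r : R) (x : V) :
  0 <= r -> rnorm (r%:C *: x) = r * rnorm x.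
Proof.
move=> r0; apply: complexI.
by rewrite rmorphM/= -!rnormE normrZ ger0_norm ?ler0c.
Qed.

Lemma rnormM x y : rnorm (x * y) <= rnorm x * rnorm y.
Proof. by rewrite -lecR rmorphM/= -!rnormE normM_le. Qed.

Lemma rnorm_star_mul x : rnorm (star x * x) = rnorm x ^+ 2.
Proof. by apply: complexI; rewrite rmorphXn/= -!rnormE starN. Qed.

Lemma star_mul_eq0 x : star x * x = 0 -> x = 0.
Proof.
move=> xx0; apply: rnorm0_eq0; apply/eqP.
by rewrite -sqrf_eq0 -rnorm_star_mul xx0 rnorm0.
Qed.

Lemma star0 : star (0 : A) = 0.
Proof. by apply: (addrI (star 0)); rewrite -starD !addr0. Qed.

Lemma starNeg x : star (- x) = - star x.
Proof. by apply/eqP; rewrite -addr_eq0 -starD addNr star0. Qed.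

Lemma starB x y : star (x - y) = star x - star y.
Proof. by rewrite starD starNeg. Qed.

Lemma star1 : star (1 : A) = 1.
Proof. by rewrite -[LHS]mul1r -{1}[1]starK -starM mul1r starK. Qed.

(** The C*-identity and submultiplicativity give [|y|^2 <= |y^*| |y|], hence [|y| <= |y^*|]; the
    converse is the same bound at [y^*]. *)
Lemma rnorm_star x : rnorm (star x) = rnorm x.
Proof.
suff le y : rnorm y <= rnorm (star y).
  by apply/eqP; rewrite eq_le le -{2}[x]starK le.
have [->|y0] := eqVneq (rnorm y) 0; first exact: rnorm_ge0.
have yp : 0 < rnorm y by rewrite lt_def y0 rnorm_ge0.
by rewrite -(ler_pM2r yp) -expr2 -rnorm_star_mul rnormM.
Qed.

(** The C*-identity at [1] reads [|1| = |1|^2], and [|1|] is nonzero because [1] is. *)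
Lemma rnorm1 : rnorm (1 : A) = 1.
Proof.
have := rnorm_star_mul 1; rewrite star1 mulr1 => /eqP.
rewrite expr2 -subr_eq0 -{1}[rnorm _]mulr1 -mulrBr mulf_eq0 => /orP[] /eqP.
  by move/rnorm0_eq0/eqP; rewrite oner_eq0.
by move/eqP; rewrite subr_eq0 => /eqP ->.
Qed.

Lemma scale_halfD x : (2^-1 : R)%:C *: x + (2^-1 : R)%:C *: x = x.
Proof.
rewrite -scalerDl -rmorphD.
have -> : 2^-1 + 2^-1 = 1 :> R by lra.
by rewrite scale1r.
Qed.

Lemma starZr (r : R) x : star (r%:C *: x) = r%:C *: star x.
Proof. by rewrite starZ realJ. Qed.

End RealNorm.

(** * The square root iteration, its rate of convergence and its limit *)

Section SquareRoot.
Context (R : realType) (A : cstarAlgType R).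
Implicit Types (x y h c : A).

Fixpoint sqrt_iter x n : A :=
  if n is m.+1 then (2^-1 : R)%:C *: (x + sqrt_iter x m * sqrt_iter x m) else 0.

(** The same iteration for the scalar [x = 1], the worst case in the unit ball; it increases to the
    fixed point 1. *)
Fixpoint sqrt_majorant n : R :=
  if n is m.+1 then (1 + sqrt_majorant m ^+ 2) / 2 else 0.

Local Notation Y := sqrt_iter.
Local Notation q := sqrt_majorant.

(** The error [e = 1 - q n] evolves by [e - e^2 / 2], which is increasing on [0, 1], so the bound
    [d = 2 / (n + 2)] can be substituted for [e]. *)
Lemma sqrt_majorant_bounds n : 0 <= 1 - q n <= 2 / n.+2%:R.
Proof.
elim: n => [|n /andP[IH0 IH1]] /=; first lra.
set e := 1 - q n in IH0 IH1 *.
have -> : 1 - (1 + q n ^+ 2) / 2 = e - e ^+ 2 / 2 by rewrite /e; field.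
have n0 : 0 <= n%:R :> R by [].
have e1 : e <= 1.
  by apply: le_trans IH1 _; rewrite ler_pdivrMr// mul1r ler_nat.
apply/andP; split; first nra.
set d := 2 / n.+2%:R in IH1.
have d1 : d <= 1 by rewrite /d ler_pdivrMr// mul1r ler_nat.
have : e - e ^+ 2 / 2 <= d - d ^+ 2 / 2 by nra.
move/le_trans; apply.
rewrite /d -[n.+3]addn3 -[n.+2]addn2 !natrD -subr_ge0.
suff -> : 2 / (n%:R + 3%:R) - (2 / (n%:R + 2%:R) - (2 / (n%:R + 2%:R)) ^+ 2 / 2) =
  2 / ((n%:R + 3%:R) * (n%:R + 2%:R) ^+ 2) :> R.
  by rewrite divr_ge0// mulr_ge0// ?sqr_ge0// addr_ge0.
by field; rewrite !gt_eqF// ltr_wpDl.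
Qed.

(** Iterates are polynomials in [x], the same ones for [x']. Two distinct arguments are allowed so
    that [c] can later be moved past roots of different elements. *)
Lemma sqrt_iter_intertwine c x x' n :
  c * x = x' * c -> c * Y x n = Y x' n * c.
Proof.
move=> cx; elim: n => [|n IH] /=; first by rewrite mulr0 mul0r.
rewrite -scalerAr -scalerAl mulrDr mulrDl cx; congr (_ *: (_ + _)).
by rewrite mulrA IH -mulrA IH mulrA.
Qed.

Lemma sqrt_iter_comm x m n : Y x m * Y x n = Y x n * Y x m.
Proof. by apply: sqrt_iter_intertwine; rewrite -(@sqrt_iter_intertwine _ x). Qed.

Lemma star_sqrt_iter x n : star x = x -> star (Y x n) = Y x n.
Proof.
move=> xs; elim: n => [|n IH] /=; first exact: star0.
by rewrite starZr starD starM xs IH.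
Qed.

Lemma rnorm_sqrt_iter x n : rnorm x <= 1 -> rnorm (Y x n) <= q n.
Proof.
move=> x1; elim: n => [|n IH] /=; first by rewrite rnorm0.
rewrite rnormZ ?invr_ge0// mulrC ler_pM2r ?invr_gt0//.
apply: le_trans (rnormD _ _) _; apply: lerD => //.
by apply: le_trans (rnormM _ _) _; rewrite expr2 ler_pM// rnorm_ge0.
Qed.

(** Since iterates commute, an increment is half the previous increment times the sum of the two
    iterates. The increments of [q] obey the same recursion, so they dominate by induction. *)
Lemma sqrt_iter_step x n :
  rnorm x <= 1 -> rnorm (Y x n.+1 - Y x n) <= q n.+1 - q n.
Proof.
move=> x1; elim: n => [|n IH].
  by have := rnorm_sqrt_iter 1 x1; rewrite !subr0.
have -> : Y x n.+2 - Y x n.+1 =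
    (2^-1 : R)%:C *: ((Y x n.+1 - Y x n) * (Y x n.+1 + Y x n)).
  rewrite [Y x n.+2]/= {3}[Y x n.+1]/= -scalerBr; congr (_ *: _).
  rewrite opprD addrACA subrr add0r mulrBl !mulrDr (sqrt_iter_comm _ n n.+1).
  by rewrite opprD addrA addrK.
have -> : q n.+2 - q n.+1 = 2^-1 * ((q n.+1 - q n) * (q n.+1 + q n)).
  by rewrite /=; field.
rewrite rnormZ ?invr_ge0// ler_pM2l ?invr_gt0//.
apply: le_trans (rnormM _ _) _; rewrite ler_pM ?rnorm_ge0//.
by apply: le_trans (rnormD _ _) _; rewrite lerD// rnorm_sqrt_iter.
Qed.

Lemma sqrt_iter_dist x m n :
  rnorm x <= 1 -> (m <= n)%N -> rnorm (Y x n - Y x m) <= 1 - q m.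
Proof.
move=> x1 /subnKC <-; set k := (n - m)%N.
have : rnorm (Y x (m + k) - Y x m) <= q (m + k) - q m.
  elim: k => [|k IH]; first by rewrite addn0 !subrr rnorm0.
  rewrite addnS -(subrKA (Y x (m + k))).
  have := sqrt_iter_step (m + k) x1.
  have := rnormD (Y x (m + k).+1 - Y x (m + k)) (Y x (m + k) - Y x m).
  lra.
by have /andP[] := sqrt_majorant_bounds (m + k); lra.
Qed.

Lemma sqrt_tail_small (e : R) : 0 < e -> exists n, 1 - q n < e.
Proof.
move=> e0; exists (Num.truncn (2 / e)).
have /andP[_ /le_lt_trans] := sqrt_majorant_bounds (Num.truncn (2 / e)); apply.
rewrite ltr_pdivrMr// mulrC -ltr_pdivrMr//.
have := truncnS_gt (2 / e) => /lt_trans; apply.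
by rewrite ltr_nat.
Qed.

(** Identities for the limit are all derived from this: the defect is bounded by a multiple of the
    error of the iterates. *)
Lemma tail_bound_eq0 (z : A) (C : R) :
  0 <= C -> (forall n, rnorm z <= C * (1 - q n)) -> z = 0.
Proof.
move=> C0 zC; apply: rnorm0_eq0; apply/eqP; rewrite eq_le rnorm_ge0 andbT.
apply/ler_addgt0Pr => e e0; rewrite add0r.
(* [C + 1] rather than [C], which may be 0. *)
have [n qn] := @sqrt_tail_small (e / (C + 1)) ltac:(apply: divr_gt0; lra).
apply: le_trans (zC n) _.
move: qn; rewrite ltr_pdivlMr; last lra.
have /andP[+ _] := sqrt_majorant_bounds n; nra.
Qed.

Lemma sqrt_iter_limit x :
  rnorm x <= 1 -> exists l, forall n, rnorm (l - Y x n) <= 1 - q n.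
Proof.
move=> x1.
have /cauchy_cvg cvY : cauchy (Y x n @[n --> \oo]).
  apply: cauchy_exP => e e0.
  have eE : e = (complex.Re e)%:C by rewrite RRe_real// gtr0_real.
  move: e0; rewrite eE ltcR => e0; have [n qn] := sqrt_tail_small e0.
  exists (Y x n); exists n => // m /= nm.
  by rewrite -ball_normE /= distrC rnormE ltcR (le_lt_trans _ qn)// sqrt_iter_dist.
exists (lim (Y x n @[n --> \oo])) => n; apply/ler_addgt0Pr => e e0.
have : \forall m \near \oo, `|lim (Y x n @[n --> \oo]) - Y x m| < e%:C.
  by move/cvgrPdist_lt : cvY; apply; rewrite ltcR.
(* An index beyond [N] is close to the limit, and one beyond [n] is within [1 - q n] of [Y x n]. *)
case=> N _ /(_ (maxn N n)) /=; rewrite leq_maxl rnormE ltcR => /(_ isT) lN.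
have := sqrt_iter_dist x1 (leq_maxr N n).
have := rnormD (lim (Y x n @[n --> \oo]) - Y x (maxn N n)) (Y x (maxn N n) - Y x n).
rewrite subrKA; lra.
Qed.

End SquareRoot.

(** * Square roots of elements in the unit ball around 1 *)

Section PositiveElements.
Context (R : realType) (A : cstarAlgType R).
Implicit Types (x y h c p a : A).

(** The limit for [x = 1 - h] is specified by its explicit error bound, the form in which it is
    used. Meaningful for [|1 - h| <= 1]; if no limit exists, the default 0 makes the value 1. *)
Definition psqrt h : A :=
  1 - xget 0 [set l | forall n,
        rnorm (l - sqrt_iter (1 - h) n) <= 1 - sqrt_majorant R n].

Lemma psqrtP h : rnorm (1 - h) <= 1 ->
  forall n, rnorm (1 - psqrt h - sqrt_iter (1 - h) n) <= 1 - sqrt_majorant R n.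
Proof.
move=> h1; rewrite /psqrt subKr; case: xgetP => [l _ //|none].
by have [l /none] := sqrt_iter_limit h1.
Qed.

Lemma rnorm_psqrt h : rnorm (1 - h) <= 1 -> rnorm (1 - psqrt h) <= 1.
Proof. by move=> /psqrtP/(_ 0); rewrite !subr0. Qed.

(** The iterates intertwine exactly, so the defect of the limits involves only the two errors
    multiplied by [c], whence the constant [2 |c|]. *)
Lemma psqrt_intertwine c h h' : rnorm (1 - h) <= 1 -> rnorm (1 - h') <= 1 ->
  c * h = h' * c -> c * psqrt h = psqrt h' * c.
Proof.
move=> /psqrtP hl /psqrtP hl' ch.
have cY n : c * sqrt_iter (1 - h) n = sqrt_iter (1 - h') n * c.
  by apply: sqrt_iter_intertwine; rewrite mulrBr mulrBl mulr1 mul1r ch.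
suff : c * (1 - psqrt h) - (1 - psqrt h') * c = 0.
  move/eqP; rewrite subr_eq0 mulrBr mulrBl mulr1 mul1r => /eqP.
  by move/addrI/oppr_inj.
apply: (@tail_bound_eq0 _ _ _ (2 * rnorm c)) => [|n].
  by rewrite mulr_ge0// rnorm_ge0.
have -> : c * (1 - psqrt h) - (1 - psqrt h') * c =
    c * (1 - psqrt h - sqrt_iter (1 - h) n) -
    (1 - psqrt h' - sqrt_iter (1 - h') n) * c.
  rewrite [in RHS]mulrBr cY; ncring.
apply: le_trans (rnormB _ _) _.
have := rnormM c (1 - psqrt h - sqrt_iter (1 - h) n).
have := rnormM (1 - psqrt h' - sqrt_iter (1 - h') n) c.
have := hl n; have := hl' n; have := rnorm_ge0 c.
nra.
Qed.

Lemma psqrt_comm x h : rnorm (1 - h) <= 1 -> x * h = h * x ->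
  x * psqrt h = psqrt h * x.
Proof. by move=> h1; apply: psqrt_intertwine. Qed.

Lemma star_psqrt h :
  rnorm (1 - h) <= 1 -> star h = h -> star (psqrt h) = psqrt h.
Proof.
move=> h1 hs; have hl := psqrtP h1.
have sY n : star (sqrt_iter (1 - h) n) = sqrt_iter (1 - h) n.
  by apply: star_sqrt_iter; rewrite starB star1 hs.
apply/eqP; rewrite -subr_eq0; apply/eqP.
apply: (@tail_bound_eq0 _ _ _ 2) => // n.
have -> : star (psqrt h) - psqrt h = (1 - psqrt h - sqrt_iter (1 - h) n)
    - star (1 - psqrt h - sqrt_iter (1 - h) n).
  rewrite !starB star1 sY; ncring.
have := rnormB (1 - psqrt h - sqrt_iter (1 - h) n)
               (star (1 - psqrt h - sqrt_iter (1 - h) n)).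
by rewrite rnorm_star; have := hl n; lra.
Qed.

Lemma psqrt_mul h : rnorm (1 - h) <= 1 -> psqrt h * psqrt h = h.
Proof.
move=> h1; have hl := psqrtP h1; set l := 1 - psqrt h in hl.
have l1 : rnorm l <= 1 by apply: rnorm_psqrt.
have rl : psqrt h = 1 - l by rewrite /l subKr.
have comm : h * l = l * h.
  by rewrite /l mulrBr mulrBl mulr1 mul1r (psqrt_comm h1 erefl).
clearbody l.
have lY n : l * sqrt_iter (1 - h) n = sqrt_iter (1 - h) n * l.
  by apply: sqrt_iter_intertwine; rewrite mulrBr mulrBl mulr1 mul1r -comm.
(* The fixed point equation of the iteration, equivalent to [(1 - l)^2 = h]. *)
suff fix_l : l + l = 1 - h + l * l.
  rewrite rl -[RHS](subKr 1) -[1 - h](addrK (l * l)) -fix_l; ncring.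
apply/eqP; rewrite -subr_eq0; apply/eqP.
apply: (@tail_bound_eq0 _ _ _ 4) => // n.
set y := sqrt_iter (1 - h) in hl lY *.
have yS : y n.+1 + y n.+1 = 1 - h + y n * y n.
  exact: scale_halfD.
(* Subtracting the recursion for [y] leaves errors only: two of step [n + 1], and one of step [n]
   times a factor of norm at most 2, hence the constant 4. *)
have -> : l + l - (1 - h + l * l) =
    (l - y n.+1) + (l - y n.+1) - (l - y n) * (l + y n).
  rewrite -(addrK (y n * y n) (1 - h)) -yS mulrDr !mulrBl lY; ncring.
have yn1 : rnorm (y n) <= 1.
  apply: le_trans (rnorm_sqrt_iter n h1) _.
  by have /andP[] := sqrt_majorant_bounds R n; lra.
have := rnormB ((l - y n.+1) + (l - y n.+1)) ((l - y n) * (l + y n)).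
have := rnormD (l - y n.+1) (l - y n.+1).
have := rnormM (l - y n) (l + y n).
have := rnormD l (y n).
have := hl n; have := hl n.+1; have := rnorm_ge0 (l - y n).
have /andP[] := sqrt_majorant_bounds R n.
have : 1 - sqrt_majorant R n.+1 <= 1 - sqrt_majorant R n.
  by rewrite /=; have := sqr_ge0 (1 - sqrt_majorant R n); lra.
nra.
Qed.

End PositiveElements.

(** * Squares of self-adjoint elements: sums, uniqueness of roots, and [a^* a] *)

Section SumsOfSquares.
Context (R : realType) (A : cstarAlgType R).
Implicit Types (x y h c p a : A).

Local Notation "'j" := ('i%C : R[i]).

Lemma sqr_imag : 'j * 'j = -1.
Proof. by rewrite -expr2 sqr_i. Qed.

Lemma star_imag x : star ('j *: x) = - ('j *: star x).
Proof.
rewrite starZ -scaleNr; congr (_ *: _).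
by apply/eqP; rewrite eq_complex /= oppr0 !eqxx.
Qed.

(** The commutator has opposite signs here and in [mul_star_cartesian]: it cancels in the sum of the
    two, and vanishes for commuting parts. *)
Lemma star_mul_cartesian x y : star x = x -> star y = y ->
  star (x + 'j *: y) * (x + 'j *: y) = x * x + y * y + 'j *: (x * y - y * x).
Proof.
move=> xs ys; rewrite starD star_imag xs ys mulrBl !mulrDr.
rewrite -!scalerAl -!scalerAr scalerA sqr_imag scaleN1r scalerBr.
ncring.
Qed.

Lemma mul_star_cartesian x y : star x = x -> star y = y ->
  (x + 'j *: y) * star (x + 'j *: y) = x * x + y * y - 'j *: (x * y - y * x).
Proof.
move=> xs ys; rewrite starD star_imag xs ys mulrDl !mulrBr.
rewrite -!scalerAl -!scalerAr scalerA sqr_imag scaleN1r scalerBr.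
ncring.
Qed.

(** For [u = x + i y] the hypotheses say [u^* u = 0], so [u = 0] and [2 x = u + u^* = 0]. *)
Lemma comm_sum_sqr_eq0 x y : star x = x -> star y = y -> x * y = y * x ->
  x * x + y * y = 0 -> x = 0.
Proof.
move=> xs ys xy xy0.
have u0 : x + 'j *: y = 0.
  by apply: star_mul_eq0; rewrite star_mul_cartesian// xy0 xy subrr scaler0 addr0.
have xx0 : x + x = 0.
  have := congr2 +%R u0 (congr1 (@star R A) u0).
  by rewrite starD star_imag xs ys star0 addr0 addrACA subrr addr0.
by apply/eqP; move/eqP: xx0; rewrite -mulr2n -scaler_nat scaler_eq0 pnatr_eq0.
Qed.

(* [u = x + i (1 - x^2)^(1/2)] is unitary, and [(1 - x^2)^(1/2)] is its
   imaginary part. *)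
Lemma rnorm_1B_sqr x : star x = x -> rnorm x <= 1 -> rnorm (1 - x * x) <= 1.
Proof.
move=> xs x1.
have h1 : rnorm (1 - (1 - x * x)) <= 1.
  by rewrite subKr (le_trans (rnormM _ _))// mulr_ile1// rnorm_ge0.
set k := psqrt (1 - x * x).
have kk : k * k = 1 - x * x by apply: psqrt_mul.
have ks : star k = k by apply: star_psqrt; rewrite // starB star1 starM xs.
have xk : x * k = k * x.
  by apply: psqrt_comm => //; rewrite mulrBl mulrBr mulr1 mul1r mulrA.
have u1 : rnorm (x + 'j *: k) = 1.
  apply/eqP; rewrite -(@pexpr_eq1 _ _ 2) ?rnorm_ge0//.
  rewrite -rnorm_star_mul star_mul_cartesian// xk subrr scaler0 addr0 kk.
  by rewrite subrKC rnorm1.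
suff k1 : rnorm k <= 1.
  by rewrite -kk (le_trans (rnormM _ _))// mulr_ile1// rnorm_ge0.
have : rnorm ('j *: (k + k)) <= 1 + 1.
  have -> : 'j *: (k + k) = (x + 'j *: k) - star (x + 'j *: k).
    by rewrite starD star_imag xs ks scalerDr; ncring.
  by have := rnormB (x + 'j *: k) (star (x + 'j *: k)); rewrite rnorm_star u1.
have -> : rnorm ('j *: (k + k)) = rnorm k *+ 2.
  apply: complexI; rewrite rmorphMn/= -!rnormE normrZ -mulr2n normrMn.
  have -> : `|'j| = 1.
    by apply/eqP; rewrite -(@pexpr_eq1 _ _ 2)// -normrX sqr_i normrN1.
  by rewrite mul1r.
by lra.
Qed.

(** The working notion of positivity; [star_mul_is_square] shows that it covers [positive_elt]. *)
Definition is_square h := exists2 x, star x = x & h = x * x.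

Lemma is_square_star h : is_square h -> star h = h.
Proof. by case=> x xs ->; rewrite starM xs. Qed.

Lemma is_square_ball h : star h = h -> rnorm (1 - h) <= 1 -> is_square h.
Proof.
by move=> hs h1; exists (psqrt h); rewrite ?psqrt_mul ?star_psqrt.
Qed.

Lemma is_square_rnorm h : is_square h -> rnorm h <= 1 -> rnorm (1 - h) <= 1.
Proof.
case=> x xs ->; rewrite -{1}xs rnorm_star_mul expr_le1 ?rnorm_ge0//.
exact: rnorm_1B_sqr.
Qed.

Lemma is_squareZ (r : R) h : 0 <= r -> is_square h -> is_square (r%:C *: h).
Proof.
move=> r0 [x xs ->]; exists ((Num.sqrt r)%:C *: x); first by rewrite starZr xs.
by rewrite -scalerAl -scalerAr scalerA -rmorphM/= -(expr2 (Num.sqrt r)) sqr_sqrtr.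
Qed.

Lemma is_squareZ_pos (r : R) h : 0 < r -> is_square (r%:C *: h) -> is_square h.
Proof.
move=> r0 /(@is_squareZ r^-1); rewrite scalerA -rmorphM/= mulVf ?gt_eqF//.
by rewrite scale1r; apply; rewrite invr_ge0 ltW.
Qed.

(** Among self-adjoint elements of the unit ball, squares are those with [|1 - h| <= 1], a convex
    condition. Both summands are scaled into the unit ball by [r], and [(r / 2) (h + h')] is their
    midpoint. *)
Lemma is_squareD h h' : is_square h -> is_square h' -> is_square (h + h').
Proof.
move=> hp hp'; have n0 := rnorm_ge0 h; have n0' := rnorm_ge0 h'.
set r := (rnorm h + rnorm h' + 1)^-1.
have d0 : 0 < rnorm h + rnorm h' + 1 by lra.
have r0 : 0 < r by rewrite invr_gt0.
have ball g : is_square g -> rnorm g <= rnorm h + rnorm h' ->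
    rnorm (1 - r%:C *: g) <= 1.
  move=> gp gr; apply: is_square_rnorm; first exact: is_squareZ (ltW r0) gp.
  by rewrite rnormZ ?(ltW r0)// /r mulrC ler_pdivrMr//; lra.
have r2 : 0 < r / 2 by lra.
apply: (is_squareZ_pos r2); apply: is_square_ball.
  by rewrite starZr starD !is_square_star.
have b := ball _ hp ltac:(lra); have b' := ball _ hp' ltac:(lra).
have -> : 1 - (r / 2)%:C *: (h + h') =
    (2^-1 : R)%:C *: ((1 - r%:C *: h) + (1 - r%:C *: h')).
  rewrite addrACA -opprD -scalerDr scalerBr scalerA (scalerDr _ (1 : A)).
  by rewrite scale_halfD -rmorphM/= mulrC.
rewrite rnormZ ?invr_ge0//.
have := rnormD (1 - r%:C *: h) (1 - r%:C *: h'); lra.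
Qed.

(** Uniqueness of the positive root. With [q] the root of [p^2] and [d = q - p], commutation gives
    [d (q + p) = 0]. Writing [q = s^2] and [p = t^2] turns this into [(s d)^2 + (t d)^2 = 0], so
    both terms vanish and [d^2 = (s^2 - t^2) d = 0]. *)
Lemma psqrt_square p : is_square p -> rnorm p <= 1 -> psqrt (p * p) = p.
Proof.
move=> pp p1; have ps := is_square_star pp.
have pb : rnorm (1 - p) <= 1 by apply: is_square_rnorm.
have ppb : rnorm (1 - p * p) <= 1 by apply: rnorm_1B_sqr.
set q := psqrt (p * p).
have qb : rnorm (1 - q) <= 1 by apply: rnorm_psqrt.
have qs : star q = q by apply: star_psqrt; rewrite // starM ps.
have qq : q * q = p * p by apply: psqrt_mul.
have pq : p * q = q * p by apply: psqrt_comm; rewrite // mulrA.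
clearbody q.
have dq : q * (q - p) = (q - p) * q by rewrite mulrBl mulrBr pq.
have dp : p * (q - p) = (q - p) * p by rewrite mulrBl mulrBr pq.
have ds : star (q - p) = q - p by rewrite starB ps qs.
have d0 : (q - p) * (q + p) = 0.
  by rewrite mulrBl !mulrDr qq pq; ncring.
have [s ss [sq sE sd]] : exists2 s, star s = s &
    [/\ s * s = q, s * psqrt p = psqrt p * s & (q - p) * s = s * (q - p)].
  exists (psqrt q); first exact: star_psqrt.
  split; [exact: psqrt_mul | symmetry; apply: psqrt_comm => //|].
    by symmetry; apply: psqrt_comm.
  exact: psqrt_comm.
set t := psqrt p in sE.
have tt : t * t = p by apply: psqrt_mul.
have ts : star t = t by apply: star_psqrt.
have td : (q - p) * t = t * (q - p) by apply: psqrt_comm.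
set d := q - p in ds d0 sd td dq dp *.
have sds : star (s * d) = s * d by rewrite starM ds ss.
have tds : star (t * d) = t * d by rewrite starM ds ts.
have sum0 : (s * d) * (s * d) + (t * d) * (t * d) = 0.
  rewrite -{1}sd -{1}td -[RHS](mul0r d) -d0 -sq -tt; ncring.
have stc : (s * d) * (t * d) = (t * d) * (s * d).
  by rewrite -!mulrA (mulrA d t) (mulrA d s) sd td -!mulrA !(mulrA s t) sE !mulrA.
have sd0 := comm_sum_sqr_eq0 sds tds stc sum0.
have td0 : t * d = 0.
  by apply: (comm_sum_sqr_eq0 tds sds); rewrite // addrC.
suff : d = 0 by move/eqP; rewrite subr_eq0 => /eqP.
apply: star_mul_eq0; rewrite ds {1}/d mulrBl -sq -tt -!mulrA sd0 td0.
by rewrite !mulr0 subrr.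
Qed.

(* [c c^* = 2 (u^2 + v^2) + s^2] for [c = u + i v], so [q := c c^*] and
   [p := s^2] are both positive; [c p = - q c] gives [c p^2 = q^2 c], and taking
   square roots, [c p = q c]. *)
Lemma star_mul_opp_square c s : star s = s -> star c * c = - (s * s) -> c = 0.
Proof.
move=> ss cs.
wlog c1 : c s ss cs / rnorm c <= 1.
  move=> small; have n0 := rnorm_ge0 c.
  set r := (rnorm c + 1)^-1.
  have d0 : 0 < rnorm c + 1 by lra.
  have r0 : 0 < r by rewrite invr_gt0.
  have /eqP : r%:C *: c = 0.
    apply: (small _ (r%:C *: s)).
    - by rewrite starZr ss.
    - by rewrite starZr -!scalerAl -!scalerAr cs !scalerN.
    - by rewrite rnormZ ?(ltW r0)// /r mulrC ler_pdivrMr//; lra.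
  rewrite scaler_eq0 => /orP[|/eqP//].
  by rewrite -(rmorph0 (real_complex R)) (inj_eq (@complexI _)) gt_eqF.
set p := s * s in cs.
have pp : is_square p by exists s.
have p1 : rnorm p <= 1.
  by rewrite -[p]opprK -cs rnormN rnorm_star_mul expr_le1// rnorm_ge0.
set q := c * star c.
have q1 : rnorm q <= 1.
  by rewrite /q -{1}[c]starK rnorm_star_mul rnorm_star expr_le1// rnorm_ge0.
have qp : is_square q.
  set u := (2^-1 : R)%:C *: (c + star c).
  set v := (2^-1 : R)%:C *: ('j *: (star c - c)).
  have us : star u = u by rewrite starZr starD starK addrC.
  have vs : star v = v.
    by rewrite starZr star_imag starB starK -scalerN opprB.
  have cE : c = u + 'j *: v.
    rewrite /u /v scalerA mulrC -scalerA -scalerDr scalerA sqr_imag scaleN1r.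
    by rewrite opprB addrACA subrr addr0 scalerDr scale_halfD.
  have -> : q = ((u * u + v * v) + (u * u + v * v)) + p.
    rewrite -[p]opprK -cs /q cE star_mul_cartesian// mul_star_cartesian//.
    ncring.
  have up : is_square (u * u) by exists u.
  have vp : is_square (v * v) by exists v.
  by do !apply: is_squareD.
have cp : q * c = - (c * p) by rewrite /q -mulrA cs mulrN.
clearbody p q.
have : c * psqrt (p * p) = psqrt (q * q) * c.
  apply: psqrt_intertwine.
  - by apply: rnorm_1B_sqr => //; apply: is_square_star.
  - by apply: rnorm_1B_sqr => //; apply: is_square_star.
  - by rewrite -mulrA cp mulrN (mulrA q) cp mulNr opprK mulrA.
rewrite !psqrt_square// cp => /eqP; rewrite -addr_eq0 => /eqP cpcp.
have cp0 : c * p = 0.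
  by apply/eqP; move/eqP: cpcp; rewrite -mulr2n -scaler_nat scaler_eq0 pnatr_eq0.
(* The C*-identity is used for [c] and for [c^* c], whose square is [- c^* c p = 0]. *)
apply: star_mul_eq0; apply: star_mul_eq0.
by rewrite starM starK {2}cs mulrN -mulrA cp0 mulr0 oppr0.
Qed.

Lemma star_mul_is_square a : is_square (star a * a).
Proof.
wlog a1 : a / rnorm a <= 1.
  move=> small; have n0 := rnorm_ge0 a.
  set r := (rnorm a + 1)^-1.
  have d0 : 0 < rnorm a + 1 by lra.
  have r0 : 0 < r by rewrite invr_gt0.
  have /small : rnorm (r%:C *: a) <= 1.
    by rewrite rnormZ ?(ltW r0)// /r mulrC ler_pdivrMr//; lra.
  rewrite starZr -scalerAl -scalerAr scalerA -rmorphM/=.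
  by apply: is_squareZ_pos; rewrite mulr_gt0.
move hE : (star a * a) => h.
have hs : star h = h by rewrite -hE starM starK.
have h1 : rnorm h <= 1 by rewrite -hE rnorm_star_mul expr_le1// rnorm_ge0.
have hb : rnorm (1 - h * h) <= 1 by apply: rnorm_1B_sqr.
set k := psqrt (h * h).
have kb : rnorm (1 - k) <= 1 by apply: rnorm_psqrt.
have ks : star k = k by apply: star_psqrt; rewrite // starM hs.
have kk : k * k = h * h by apply: psqrt_mul.
have hk : h * k = k * h by apply: psqrt_comm; rewrite // mulrA.
clearbody k; set g := k - h.
have gs : star g = g by rewrite starB ks hs.
have hg : h * g = - (k * g) by rewrite !mulrBr -kk hk opprB.
have gk : g * k = k * g by rewrite mulrBl mulrBr hk.
(* The root of [k] commutes with [g], so that [k g^2 = (w g)^2] is the square of a self-adjoint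
   element. *)
set w := psqrt k.
have ws : star w = w by apply: star_psqrt.
have ww : w * w = k by apply: psqrt_mul.
have gw : g * w = w * g by apply: psqrt_comm.
have ag0 : a * g = 0.
  apply: (@star_mul_opp_square _ (w * g)); first by rewrite starM ws gs.
  rewrite starM gs -mulrA (mulrA (star a)) hE hg -{1}gw mulrN -ww.
  by rewrite !mulrA.
have hg0 : h * g = 0 by rewrite -hE -mulrA ag0 mulr0.
have kg0 : k * g = 0 by apply/eqP; rewrite -oppr_eq0 -hg hg0.
have : g = 0 by apply: star_mul_eq0; rewrite gs {1}/g mulrBl kg0 hg0 subrr.
move/eqP; rewrite subr_eq0 => /eqP <-; exact: is_square_ball.
Qed.

End SumsOfSquares.

(** * States: positivity, Cauchy-Schwarz and Buzano inequalities *)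

Lemma normcRE (R : realType) (z : R[i]) : `|z| = (rnorm (z : R[i]^o))%:C.
Proof. by rewrite /rnorm RRe_real ?normr_real. Qed.

Section States.
Context (R : realType) (A : cstarAlgType R).
Context (f : {linear A -> R[i]^o}) (fS : states f).
Implicit Types (x y a : A).

Lemma state1 : f 1 = 1. Proof. by case: fS. Qed.

Lemma state_scale (c : R[i]) x : f (c *: x) = c * f x.
Proof. by rewrite linearZ_LR. Qed.

Lemma stateB x y : f (x - y) = f x - f y.
Proof. exact: linearB. Qed.

Lemma state_bound x : rnorm (f x) <= rnorm x.
Proof.
have [_ _ f1] := fS.
have ub : has_ubound [set rnorm (f x) | x in [set x : A | rnorm x <= 1]].
  apply: contrapT => nub; move: f1; rewrite /opnorm sup_out; last by case.
  by move/eqP; rewrite eq_sym oner_eq0.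
have [x0|x0] := eqVneq (rnorm x) 0.
  by rewrite (rnorm0_eq0 x0) linear0 !rnorm0.
have xp : 0 < rnorm x by rewrite lt_def x0 rnorm_ge0.
have : rnorm (f ((rnorm x)^-1%:C *: x)) <= 1.
  rewrite -f1; apply: ub_le_sup => //=; exists ((rnorm x)^-1%:C *: x) => //=.
  by rewrite rnormZ ?invr_ge0 ?(ltW xp)// mulVf.
by rewrite state_scale rnormZ ?invr_ge0 ?(ltW xp)// mulrC ler_pdivrMr// mul1r.
Qed.

(* Otherwise [|f (x + i t)|] exceeds [|x + i t| <= (|x|^2 + t^2)^(1/2)] for a
   suitable real [t]. *)
Lemma state_real x : star x = x -> complex.Im (f x) = 0.
Proof.
move=> xs; apply/eqP; apply: contraT => b0.
set b := complex.Im (f x) in b0.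
(* Chosen so that [2 b t = |x|^2 + 1]: then [(b + t)^2 <= |x|^2 + t^2] would give [b^2 + 1 <= 0]. *)
set t := (rnorm x ^+ 2 + 1) / (2 * b).
set u := x + 'i%C *: (t%:C *: 1).
have fle : (b + t) ^+ 2 <= rnorm (f u) ^+ 2.
  rewrite -lecR [leRHS]rmorphXn/= -rnormE -add_Re2_Im2 lecR.
  rewrite /u linearD !state_scale state1 mulr1 /b; case: (f x) => p q /=.
  by have := sqr_ge0 p; lra.
have ule : rnorm u ^+ 2 <= rnorm x ^+ 2 + t ^+ 2.
  rewrite -rnorm_star_mul star_mul_cartesian// ?starZr ?star1//.
  have -> : x * (t%:C *: 1) = (t%:C *: 1) * x.
    by rewrite -scalerAr -scalerAl mulr1 mul1r.
  rewrite subrr scaler0 addr0.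
  apply: le_trans (rnormD _ _) _; rewrite -{1}xs rnorm_star_mul lerD2l.
  rewrite -scalerAr -scalerAl mulr1 scalerA -rmorphM/=.
  by rewrite -expr2 rnormZ ?sqr_ge0// rnorm1 mulr1.
have fu : rnorm (f u) ^+ 2 <= rnorm u ^+ 2.
  by rewrite ler_pXn2r ?nnegrE ?rnorm_ge0// state_bound.
have tb : 2 * b * t = rnorm x ^+ 2 + 1.
  by rewrite /t mulrC divfK// mulf_neq0// pnatr_eq0.
by have := sqr_ge0 b; nra.
Qed.

(** For [h = x^* x] scaled by [r] into the unit ball, [|1 - r h| <= 1] because [h] is a square.
    Hence [|1 - r f(h)| <= 1], which forces the real number [f(h)] to be nonnegative. *)
Lemma state_ge0 x : 0 <= f (star x * x).
Proof.
have sq := star_mul_is_square x.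
move: (star x * x) sq => h hp.
have fr : f h = (complex.Re (f h))%:C.
  by rewrite [LHS]complexE state_real ?is_square_star// mulr0 addr0.
rewrite fr ler0c; have n0 := rnorm_ge0 h.
set r := (rnorm h + 1)^-1.
have d0 : 0 < rnorm h + 1 by lra.
have r0 : 0 < r by rewrite invr_gt0.
have rh1 : rnorm (1 - r%:C *: h) <= 1.
  apply: is_square_rnorm; first exact: is_squareZ (ltW r0) hp.
  by rewrite rnormZ ?(ltW r0)// /r mulrC ler_pdivrMr//; lra.
have := le_trans (state_bound _) rh1.
rewrite linearB state_scale state1 fr -lecR -rnormE.
rewrite -(rmorph1 (real_complex R)) -rmorphM -rmorphB normc_def lecR /=.
rewrite expr0n addr0 sqrtr_sqr ler_norml => /andP[_].
by rewrite lerBlDr lerDl pmulr_rge0.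
Qed.

Lemma state_star x : f (star x) = Num.conj (f x).
Proof.
have re : complex.Im (f (x + star x)) = 0.
  by apply: state_real; rewrite starD starK addrC.
have im : complex.Im (f ('i%C *: (x - star x))) = 0.
  by apply: state_real; rewrite star_imag starB starK -scalerN opprB.
move: re im; rewrite state_scale linearD linearB /=.
case: (f x) (f (star x)) => [u v] [u' v'] /= re im.
apply/eqP; rewrite eq_complex /=; apply/andP; split; apply/eqP; lra.
Qed.

(** Nonnegativity of the variance: expand [f(y^* y) >= 0] at [y = a - f(a) 1]. *)
Lemma state_sqr_le a : `|f a : R[i]| ^+ 2 <= f (star a * a).
Proof.
have := state_ge0 (a - (f a) *: 1).
rewrite starB starZ star1 mulrBl !mulrBr -!scalerAl -!scalerAr !mul1r !mulr1.
rewrite !stateB !state_scale state1 mulr1 state_star.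
by rewrite subrr subr0 subr_ge0 normCK.
Qed.

(** Cauchy-Schwarz in additive form: the phase [w] rotates [f(y^* x)] onto its modulus, and [f] is
    nonnegative on the square of [x - w y]. *)
Lemma state_norm_le x y :
  `|f (star y * x) : R[i]| *+ 2 <= f (star x * x) + f (star y * y).
Proof.
set z := f (star y * x).
have zs : f (star x * y) = Num.conj z by rewrite -state_star starM starK.
have [w ww wz] : exists2 w : R[i], Num.conj w * w = 1 & Num.conj w * z = `|z|.
  have [->|z0] := eqVneq z 0; first by
    exists 1; rewrite ?rmorph1 ?mulr0 ?normr0 ?mulr1.
  have nz : `|z| != 0 by rewrite normr_eq0.
  have nzJ : Num.conj `|z| = `|z| by apply: conj_Creal; exact: normr_real.
  exists (z / `|z|); rewrite rmorphM fmorphV/= nzJ.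
    by rewrite mulrACA -invfM [_^* * _]mulrC -normCK -expr2 divff// expf_neq0.
  by rewrite mulrAC [_^* * _]mulrC -normCK expr2 mulfK.
have wz' : w * Num.conj z = `|z|.
  by rewrite -(conj_Creal (normr_real z)) -wz rmorphM/= conjCK.
have := state_ge0 (x - w *: y).
rewrite starB starZ mulrBl !mulrBr -!scalerAl -!scalerAr !stateB !state_scale.
rewrite zs -/z wz wz' mulrA ww mul1r.
by rewrite subr_ge0 lerBrDr addrAC lerBlDr mulr2n.
Qed.

Lemma state_buzano a :
  `|f a : R[i]| ^+ 2 *+ 4 <=
  `|f (a ^+ 2) : R[i]| *+ 2 + f (star a * a) + f (a * star a).
Proof.
set l := f a.
have := state_norm_le ((l *+ 2) *: 1 - a) (star a).
rewrite starK starB starZ star1 rmorphMn/=.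
rewrite mulrBr -scalerAr mulr1 -expr2 stateB state_scale -/l.
rewrite mulrBl !mulrBr -!scalerAl -!scalerAr !mul1r !mulr1 !stateB !state_scale.
rewrite state1 state_star -/l.
have -> : (l^* *+ 2 * (l *+ 2 * 1) - l^* *+ 2 * l - (l *+ 2 * l^* - f (star a * a)))
  = f (star a * a).
  ring.
move=> le.
have : `|l ^+ 2| *+ 2 <= `|l *+ 2 * l - f (a ^+ 2)| + `|f (a ^+ 2) : R[i]|.
  rewrite -normrMn; apply: le_trans (ler_normD _ _).
  by rewrite subrK expr2 mulrnAl.
rewrite normrX => le2.
rewrite (mulrnA _ 2 2) -addrA.
have := lerMn2r 2 (`|l| ^+ 2 *+ 2)
  (`|l *+ 2 * l - f (a ^+ 2)| + `|f (a ^+ 2) : R[i]|).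
rewrite le2 orbT => /idP/le_trans; apply.
by rewrite [leLHS]mulrnDl [leRHS]addrC lerD2r.
Qed.

Lemma state_convex a (t : R) : 0 <= t <= 1 ->
  `|f a : R[i]| ^+ 2 <= (t / 2)%:C * `|f (a ^+ 2) : R[i]|
    + f ((1 - 3 * t / 4)%:C *: (star a * a) + (t / 4)%:C *: (a * star a)).
Proof.
move=> /andP[t0 t1].
have := state_sqr_le a; have := state_buzano a.
have := state_ge0 a; have := state_ge0 (star a); rewrite starK.
rewrite linearD !state_scale.
have reE (z : R[i]) : 0 <= z -> z = (complex.Re z)%:C.
  by move=> z0; rewrite RRe_real// ger0_real.
move=> /reE -> /reE ->.
rewrite !normcRE -!rmorphMn -!rmorphXn -!rmorphM -!rmorphMn -!rmorphD !lecR.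
set L := rnorm _ ^+ 2; set F := rnorm _.
set X := complex.Re (f (star a * a)); set Y := complex.Re _.
move=> B S; nra.
Qed.

Lemma state_convex_rnorm a (t : R) : 0 <= t <= 1 ->
  rnorm (f a) ^+ 2 <= t / 2 * rnorm (f (a ^+ 2))
    + rnorm ((t / 4)%:C *: (a * star a) + (1 - 3 * t / 4)%:C *: (star a * a)).
Proof.
move=> /(state_convex a); rewrite addrC.
rewrite !normcRE -rmorphXn -rmorphM [_ *: (a * _) + _]addrC.
set z := _ *: _ + _; rewrite lecE => /andP[_ /=].
case fz : (f z) => [u v] /= le.
have := state_bound z; have := normc_ge_Re (f z).
by rewrite normcRE lecR fz /=; have := ler_norm u; lra.
Qed.

End States.

Section NumericalRadius.
Context (R : realType) (A : cstarAlgType R).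
Implicit Types (a x h : A).

Lemma numradius_ub (f : {linear A -> R[i]^o}) a :
  states f -> rnorm (f a) <= numradius a.
Proof.
move=> fS; apply: ub_le_sup; last by exists f.
by exists (rnorm a) => _ [g gS <-]; exact: state_bound.
Qed.

Lemma numradius_ge0 a : 0 <= numradius a.
Proof.
have [s0|/set0P[f fS]] := eqVneq (@states R A) set0; last first.
  exact: le_trans (rnorm_ge0 _) (numradius_ub a fS).
by rewrite /numradius s0 image_set0 sup0.
Qed.

Lemma numradius_sqr_le a (K : R) : 0 <= K ->
  (forall f : {linear A -> R[i]^o}, states f -> rnorm (f a) ^+ 2 <= K) ->
  numradius a ^+ 2 <= K.
Proof.
move=> K0 aK; rewrite -[leRHS]sqr_sqrtr// ler_pXn2r ?nnegrE
  ?numradius_ge0 ?sqrtr_ge0//.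
have [s0|/set0P[f fS]] := eqVneq (@states R A) set0; last first.
  apply: sup_le_ub; first by exists (rnorm (f a)); exists f.
  move=> _ [g gS <-].
  by rewrite -(ger0_norm (rnorm_ge0 (g a))) -sqrtr_sqr ler_wsqrtr// aK.
by rewrite /numradius s0 image_set0 sup0 sqrtr_ge0.
Qed.

Lemma numradius_star a : numradius (star a) = numradius a.
Proof.
congr sup; apply/seteqP; split => _ [f fS <-]; exists f => //;
by rewrite /rnorm state_star// norm_conjC.
Qed.

Lemma is_square_sqrt h : is_square h -> exists2 k, is_square k & k ^+ 2 = h.
Proof.
move=> hp; have n0 := rnorm_ge0 h.
set s := rnorm h + 1; have s1 : 1 <= s by rewrite lerDr.
have s0 : 0 <= s ^- 2 by rewrite invr_ge0 sqr_ge0.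
set g := (s ^- 2)%:C *: h.
have gp : is_square g by apply: is_squareZ.
have gb : rnorm (1 - g) <= 1.
  apply: is_square_rnorm => //; rewrite rnormZ// mulrC ler_pdivrMr; last nra.
  by rewrite /s in s1 *; nra.
exists (s%:C *: psqrt g).
  apply: is_squareZ; first lra.
  by apply: is_square_ball; [exact/star_psqrt/is_square_star | exact: rnorm_psqrt].
rewrite exprZn (expr2 (psqrt g)) psqrt_mul// /g scalerA
  -rmorphXn -rmorphM mulfV ?scale1r//.
by rewrite sqrf_eq0; lra.
Qed.

Lemma cstar_abs_sqr a : cstar_abs a ^+ 2 = star a * a.
Proof.
rewrite /cstar_abs /cstar_sqrt; case: xgetP => [y _ [_ ->//]|none].
have [k [x xs kE] k2] := is_square_sqrt (star_mul_is_square a).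
by case: (none k); split=> //; exists x; rewrite xs.
Qed.

Lemma numradius_convex a (t : R) : 0 <= t <= 1 ->
  numradius a ^+ 2 <= t / 2 * numradius (a ^+ 2)
    + rnorm ((t / 4)%:C *: (a * star a) + (1 - 3 * t / 4)%:C *: (star a * a)).
Proof.
move=> t01; have /andP[t0 t1] := t01; apply: numradius_sqr_le.
  by rewrite addr_ge0 ?rnorm_ge0// mulr_ge0 ?numradius_ge0//; lra.
move=> f fS; apply: le_trans (state_convex_rnorm fS a t01) _.
by rewrite lerD2r ler_wpM2l ?numradius_ub//; lra.
Qed.

End NumericalRadius.

Theorem theorem3p7 (R : realType) (A : cstarAlgType R) (a : A) :
  [/\ forall f : {linear A -> R[i]^o}, states f ->
        forall t : R, 0 <= t <= 1 ->
        `|f a : R[i]| ^+ 2 <=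
          (t / 2)%:C * `|f (a ^+ 2) : R[i]|
          + f ((1 - 3 * t / 4)%:C *: (star a * a) + (t / 4)%:C *: (a * star a)),
      forall t : R, 0 <= t <= 1 ->
        numradius a ^+ 2 <=
          t / 2 * numradius (a ^+ 2)
          + rnorm ((t / 4)%:C *: cstar_abs (star a) ^+ 2
                   + (1 - 3 * t / 4)%:C *: cstar_abs a ^+ 2),
      forall t : R, 0 <= t <= 1 ->
        numradius a ^+ 2 <=
          t / 2 * numradius (a ^+ 2)
          + rnorm ((t / 4)%:C *: cstar_abs a ^+ 2
                   + (1 - 3 * t / 4)%:C *: cstar_abs (star a) ^+ 2)
    & numradius a ^+ 2 <=
        1 / 2 * numradius (a ^+ 2)
        + 1 / 4 * rnorm (star a * a + a * star a)].
Proof.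
split=> [f fS t t01|t t01|t t01|].
- exact: state_convex.
- by rewrite !cstar_abs_sqr starK numradius_convex.
- have := numradius_convex (star a) t01.
  have -> : star a ^+ 2 = star (a ^+ 2) by rewrite !expr2 starM.
  by rewrite !numradius_star !cstar_abs_sqr starK.
have := @numradius_convex R A a 1; rewrite ler01 lexx => /(_ isT).
have -> : 1 - 3 * 1 / 4 = 1 / 4 :> R by lra.
by rewrite -scalerDr rnormZ 1?[X in rnorm X]addrC//; lra.
Qed.
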